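(* Let $\mathcal{M}$ be a compact Riemannian manifold, let $Z$ be a Gaussian process on $\mathcal{M}$ with twice differentiable mean function $\mu$ and covariance function $K$, and let $U,V$ be smooth vector fields on $\mathcal{M}$. If $Z$ is 2-MSD, then $D^2_{U,V}Z$ is a valid Gaussian process on $\mathcal{M}$ with mean function $x\mapsto\nabla^2\mu(x)(V_x,U_x)$ and covariance function $$K_{U,V}(x,x')=(\nabla_{12}K_V(x,x'))(U_x,U_{x'})=\nabla_{1212}K(x,x')(V_x,V_{x'},U_x,U_{x'}),$$ where $K_V(x,x')=\operatorname{Cov}(D_VZ(x),D_VZ(x'))$.
   Context: $\exp_x$ is the Riemannian exponential map, $V_x=V(x)$, $U_x=U(x)$. $Z$ is 1-MSD if for all $x$ and all geodesics $\gamma$ with $\gamma(0)=x$, $\lim_{t\to0}\mathbb{E}\big(\frac{Z(\gamma(t))-Z(x)}{t}\big)^2$ exists (finite). The derivative process is the mean-square limit $D_VZ(x)=\lim_{t\to0}\frac{Z(\exp_x(tV_x))-Z(x)}{t}$. A 1-MSD $Z$ is 2-MSD if for all $x$, all geodesics $\gamma$ with $\gamma(0)=x$ and all smooth vector fields $V$, $\lim_{t\to0}\mathbb{E}\big(\frac{D_VZ(\gamma(t))-D_VZ(x)}{t}\big)^2$ exists (finite). The curvature process is the mean-square limit $D^2_{U,V}Z(x)=\lim_{t\to0}\frac{D_VZ(\exp_x(tU_x))-D_VZ(x)}{t}$. These mean-square limits are taken to exist. Notation for derivatives: for a function $h$ on $\mathcal{M}$, $\nabla h(V_x)=\langle\nabla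 h(x),V_x\rangle$, and $\nabla^2h(x)(V_x,U_x)$ is the iterated derivative $\frac{d}{dt}\langle\nabla h(\exp_x(tU_x)),V_{\exp_x(tU_x)}\rangle|_{t=0}$. For a function $L$ on $\mathcal{M}\times\mathcal{M}$, $(\nabla_{12}L(x,x'))(U_x,U_{x'})$ is the mixed directional derivative along $U_x$ in the first and $U_{x'}$ in the second argument, $\lim_{t,s\to0}\frac1{ts}[L(\exp_x(tU_x),\exp_{x'}(sU_{x'}))-L(\exp_x(tU_x),x')-L(x,\exp_{x'}(sU_{x'}))+L(x,x')]$. $\nabla_{1212}K(x,x')(V_x,V_{x'},U_x,U_{x'})$ denotes the iterated partial derivative of $K$, first along the field $V$ in both arguments, then along $U$ in both arguments. *)

(* Defs.v *)
From HB Require Import structures.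
From mathcomp Require Import all_boot all_order all_algebra.
From mathcomp Require Import all_classical all_reals all_analysis.

Set Implicit Arguments.
Unset Strict Implicit.
Unset Printing Implicit Defensive.

Import Order.TTheory GRing.Theory Num.Def Num.Theory.
Import numFieldTopology.Exports numFieldNormedType.Exports.

Local Open Scope classical_set_scope.
Local Open Scope ring_scope.

(* [k] times Frechet differentiable at every point of [O] (meant for [O] open);
   "for all [k]" is then C^oo. *)
Fixpoint times_differentiable_on (R : realType) (n : nat) (W : normedModType R)
    (k : nat) (O : set 'rV[R]_n) (f : 'rV[R]_n -> W) : Prop :=
  if k is k'.+1 then
    (forall u, O u -> differentiable f u) /\
    (forall j : 'I_n,
        times_differentiable_on k' O (fun u => 'D_(delta_mx 0 j) f u))
  else True.

Definition smooth_on (R : realType) (n : nat) (W : normedModType R)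
    (O : set 'rV[R]_n) (f : 'rV[R]_n -> W) : Prop :=
  forall k, times_differentiable_on k O f.

(* Smooth n-manifolds without boundary. The atlas is indexed by the points of
   the manifold, [chart p] being a chart around [p] with domain [dom p] and
   inverse [param p]; this loses no generality, since any sub-atlas that covers
   determines the smooth structure. The values of [chart p] off [dom p] and of
   [param p] off the image of the chart are irrelevant. *)
Record smooth_manifold (R : realType) (n : nat) := SmoothManifold {
  carrier :> topologicalType ;
  carrier_hausdorff : hausdorff_space carrier ;
  carrier_second_countable : @second_countable carrier ;
  dom : carrier -> set carrier ;
  chart : carrier -> carrier -> 'rV[R]_n ;
  param : carrier -> 'rV[R]_n -> carrier ;
  dom_open : forall p, open (dom p) ;
  dom_self : forall p, dom p p ;
  chart_image_open : forall p, open (chart p @` dom p) ;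
  chartK : forall p x, dom p x -> param p (chart p x) = x ;
  chart_continuous : forall p x, dom p x -> {for x, continuous (chart p)} ;
  param_continuous : forall p u, (chart p @` dom p) u ->
    {for u, continuous (param p)} ;
  transition_smooth : forall p q,
    smooth_on (chart p @` (dom p `&` dom q)) (chart q \o param p)
}.

Section Geometry.
Context {R : realType} {n : nat}.
Implicit Type M : smooth_manifold R n.

Definition chart_image M (p : M) : set 'rV[R]_n := chart p @` dom p.

(* T_x M is 'rV_n, a tangent vector at x being given by its coordinates in the
   chart around x. Likewise a vector field is a map M -> 'rV_n and a field of
   bilinear forms a map M -> 'M_n; the next two definitions give their
   coordinate expressions in an arbitrary chart [p] (a tangent vector [v] at x
   in the coordinates of [p] becomes [v *m 'J (chart x \o param p) (chart p x)]
   in those of the chart around x). *)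
Definition field_in M (V : M -> 'rV[R]_n) (p : M) (u : 'rV[R]_n) : 'rV[R]_n :=
  let x := param p u in V x *m 'J (chart p \o param x) (chart x x).

Definition form_in M (g : M -> 'M[R]_n) (p : M) (u : 'rV[R]_n) : 'M[R]_n :=
  let x := param p u in
  let J := 'J (chart x \o param p) u in J *m g x *m J^T.

Definition smooth_vector_field M (V : M -> 'rV[R]_n) : Prop :=
  forall p, smooth_on (chart_image p) (field_in V p).

Definition twice_differentiable M (h : M -> R) : Prop :=
  forall p, times_differentiable_on 2 (chart_image p) (h \o param p).

Record riemannian_metric M := RiemannianMetric {
  gram :> M -> 'M[R]_n ;
  gram_sym : forall x, (gram x)^T = gram x ;
  gram_pos : forall x (v : 'rV[R]_n), v != 0 ->
    0 < (v *m gram x *m v^T) 0 0 ;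
  gram_smooth : forall p, smooth_on (chart_image p) (form_in gram p)
}.

Definition inner M (g : riemannian_metric M) (x : M) (v w : 'rV[R]_n) : R :=
  (v *m g x *m w^T) 0 0.

(* Gradient: the coordinates of dh raised by the inverse metric. *)
Definition gradient M (g : riemannian_metric M) (h : M -> R) (x : M)
    : 'rV[R]_n :=
  (\row_j 'D_(delta_mx 0 j) (h \o param x) (chart x x)) *m invmx (g x).

Definition christoffel M (g : riemannian_metric M) (p : M) (u : 'rV[R]_n)
    (k i j : 'I_n) : R :=
  let G := form_in g p in
  let pd (a b c : 'I_n) := 'D_(delta_mx 0 a) (fun w => G w b c : R) u in
  2^-1 * \sum_(l < n) invmx (G u) k l * (pd i j l + pd j i l - pd l i j).

(* Geodesics are parametrized by all of R. *)
Definition geodesic M (g : riemannian_metric M) (gamma : R -> M) : Prop :=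
  continuous gamma /\
  forall p t, dom p (gamma t) ->
    let c := fun s : R => chart p (gamma s) in
    [/\ derivable c t 1, derivable (derive1 c) t 1 &
        forall k : 'I_n,
          derive1 (derive1 c) t 0 k
          + \sum_(i < n) \sum_(j < n)
              christoffel g p (c t) k i j * derive1 c t 0 i * derive1 c t 0 j = 0].

Definition velocity M (gamma : R -> M) (t : R) : 'rV[R]_n :=
  derive1 (fun s : R => chart (gamma t) (gamma s)) t.

(* exp_x(v) = gamma(1), gamma being the geodesic starting at x with velocity v;
   the first conjunct says that exp is defined on the whole tangent bundle. *)
Definition exponential_map M (g : riemannian_metric M)
    (e : M -> 'rV[R]_n -> M) : Prop :=
  forall (x : M) (v : 'rV[R]_n),
    let starts gamma :=
      [/\ geodesic g gamma, gamma 0 = x & velocity gamma 0 = v] in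
    (exists gamma, starts gamma) /\
    (forall gamma, starts gamma -> e x v = gamma 1).

Definition grad_along M (g : riemannian_metric M) (h : M -> R)
    (V : M -> 'rV[R]_n) (x : M) : R :=
  inner g x (gradient g h x) (V x).

(* The function of t whose derivative at 0 is the second derivative
   of h at x in the directions V_x, U_x. *)
Definition hessian_curve M (g : riemannian_metric M) (e : M -> 'rV[R]_n -> M)
    (h : M -> R) (V U : M -> 'rV[R]_n) (x : M) (t : R) : R :=
  grad_along g h V (e x (t *: U x)).

Definition hessian M (g : riemannian_metric M) (e : M -> 'rV[R]_n -> M)
    (h : M -> R) (V U : M -> 'rV[R]_n) (x : M) : R :=
  derive1 (hessian_curve g e h V U x) 0.

Definition mixed_quotient M (e : M -> 'rV[R]_n -> M) (U : M -> 'rV[R]_n)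
    (L : M -> M -> R) (x x' : M) (ts : R * R) : R :=
  let y := e x (ts.1 *: U x) in
  let y' := e x' (ts.2 *: U x') in
  (ts.1 * ts.2)^-1 * (L y y' - L y x' - L x y' + L x x').

Definition mixed_filter : set_system (R * R) :=
  filter_prod (0 : R)^' (0 : R)^'.

Definition mixed_derivable M (e : M -> 'rV[R]_n -> M) (U : M -> 'rV[R]_n)
    (L : M -> M -> R) (x x' : M) : Prop :=
  cvg (mixed_quotient e U L x x' @ mixed_filter).

Definition mixed_derivative M (e : M -> 'rV[R]_n -> M) (U : M -> 'rV[R]_n)
    (L : M -> M -> R) (x x' : M) : R :=
  lim (mixed_quotient e U L x x' @ mixed_filter).

End Geometry.

Section Processes.
Context {d : measure_display} {Om : measurableType d} {R : realType}.
Implicit Type P : probability Om R.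

(* Univariate normal law, the degenerate case (a point mass) included. *)
Definition normal_variable P (X : Om -> R) : Prop :=
  (exists m s : R, 0 < s /\
     forall A, measurable A -> P (X @^-1` A) = normal_prob m s A) \/
  (exists m : R, forall A, measurable A -> P (X @^-1` A) = \d_m A).

(* The finite-dimensional distributions are (possibly degenerate) multivariate
   normal, i.e. all linear combinations of their components are normal. *)
Definition gaussian_process P (T : Type) (Z : T -> {RV P >-> R})
    (mu : T -> R) (K : T -> T -> R) : Prop :=
  [/\ forall (k : nat) (x : 'I_k -> T) (a : 'I_k -> R),
        normal_variable P (fun w => \sum_(i < k) a i * Z (x i) w),
      forall x, ('E_P[Z x] = (mu x)%:E)%E &
      forall x x', (covariance P (Z x) (Z x') = (K x x')%:E)%E].

Definition cov_fun P (T : Type) (Z : T -> {RV P >-> R}) (x x' : T) : R :=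
  fine (covariance P (Z x) (Z x')).

Context {n : nat} {M : smooth_manifold R n}.

(* [DZ] is a version of D_V Z; mean-square limits are only defined up to
   almost-sure equality. *)
Definition derivative_process P (e : M -> 'rV[R]_n -> M) (V : M -> 'rV[R]_n)
    (Z DZ : M -> {RV P >-> R}) : Prop :=
  forall x,
    (fun t : R =>
       'E_P[fun w => (((Z (e x (t *: V x)) w - Z x w) / t - DZ x w) ^+ 2)%R]%E)
      @ (0 : R)^' --> (0%:E : \bar R).

(* The mean-square differentiability condition of order one. *)
Definition MSD1 P (g : riemannian_metric M) (Z : M -> {RV P >-> R}) : Prop :=
  forall (x : M) (gamma : R -> M), geodesic g gamma -> gamma 0 = x ->
    exists l : R,
      (fun t : R => 'E_P[fun w => (((Z (gamma t) w - Z x w) / t) ^+ 2)%R]%E)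
        @ (0 : R)^' --> (l%:E : \bar R).

(* The second-order requirement on Z along W is [MSD1] for D_W Z. *)
Definition MSD2 P (g : riemannian_metric M) (e : M -> 'rV[R]_n -> M)
    (Z : M -> {RV P >-> R}) : Prop :=
  MSD1 g Z /\
  forall W : M -> 'rV[R]_n, smooth_vector_field W ->
    exists2 DZ : M -> {RV P >-> R},
      derivative_process e W Z DZ & MSD1 g DZ.

End Processes.

(* Main.v *)
(** Idea. Everything is L^2 calculus: expectations and covariances are
    continuous for mean-square convergence, and a mean-square limit of
    (possibly degenerate) normal variables is normal. Hence if [DZ] is the
    derivative process of a Gaussian process with mean [mu] and covariance [K],
    then [DZ] is Gaussian, its mean is the limit of the difference quotients of
    [mu], and its covariance is the limit of the mixed difference quotients of
    [K]. This is applied twice, to [Z] and to [D_V Z].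

    Rescaling geodesics gives exp_x (t v) = gamma t, so the mean of [D_V Z] is
    the derivative of [mu] along a geodesic, i.e. the pairing of the gradient of
    [mu] with [V].

    For the closure of normal laws: a normal law N(m, s) has mean [m + s c] and
    variance [s^2 v], with [c] and [v] the mean and variance of N(0, 1), so [m]
    and [s] converge along with the mean and the variance; the values of [c] and
    [v] are not needed. *)
Require Import Defs.
From mathcomp Require Import all_boot all_order all_algebra.
From mathcomp Require Import all_classical all_reals all_analysis.
From mathcomp Require Import measurable_realfun ring lra.

Set Implicit Arguments.
Unset Strict Implicit.
Unset Printing Implicit Defensive.

Import Order.TTheory GRing.Theory Num.Def Num.Theory.
Import numFieldTopology.Exports numFieldNormedType.Exports.

Local Open Scope classical_set_scope.
Local Open Scope ring_scope.

(** * Geodesics, the exponential map and gradients *)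

Section Geodesics.
Context {R : realType}.

Lemma derive1_mull (W : normedModType R) (f : R -> W) (a t : R) :
  derivable f (a * t) 1 ->
  derivable (fun s => f (a * s)) t 1 /\
  derive1 (fun s => f (a * s)) t = a *: derive1 f (a * t).
Proof.
move=> /derivable1_diffP df.
have [da Da] : is_diff t ( *%R a : R -> R) ( *%R a) := is_diff_scaler a t.
have dfa : differentiable (f \o *%R a) t by exact: differentiable_comp.
split; first exact/derivable1_diffP.
rewrite (derive1E' dfa) diff_comp//= derive1E'// Da/= mulr1.
have -> : 'd f (a * t) a = 'd f (a * t) (a *: (1 : R)).
  by congr ('d f (a * t) _); rewrite -[RHS]/(a * 1) mulr1.
by rewrite linearZ.
Qed.

(** The first-order formula has to hold on a neighbourhood of [t] before it can be differentiated
    again, hence the [\near] hypothesis. *)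
Lemma derive1_mull2 (W : normedModType R) (f : R -> W) (a t : R) :
  (\forall s \near t, derivable f (a * s) 1) ->
  derivable (derive1 f) (a * t) 1 ->
  derivable (derive1 (fun s => f (a * s))) t 1 /\
  derive1 (derive1 (fun s => f (a * s))) t =
    a ^+ 2 *: derive1 (derive1 f) (a * t).
Proof.
move=> df /derive1_mull[ddf Df].
set h := fun s => derive1 f (a * s) in ddf Df.
have fE : {near t, a \*: h =1 derive1 (fun s => f (a * s))}.
  by apply: filterS df => s /derive1_mull[_ ->].
split; first by apply: near_eq_derivable fE _; exact: derivableZ.
have ahE : 'D_1 (a \*: h) t = a ^+ 2 *: derive1 (derive1 f) (a * t).
  by rewrite (deriveZ a ddf) -derive1E Df scalerA -expr2.
by rewrite derive1E -ahE; apply/esym/near_eq_derive.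
Qed.

Context {n : nat} {M : smooth_manifold R n} (g : riemannian_metric M).

(** The geodesic equation is homogeneous: the acceleration and the term quadratic in the velocity
    both pick up the factor [a ^+ 2]. *)
Lemma geodesic_rescale (gamma : R -> M) (a : R) :
  geodesic g gamma -> geodesic g (fun s => gamma (a * s)).
Proof.
move=> [cgamma gammaP]; split.
  by move=> t; apply: continuous_comp; [exact: mulrl_continuous|exact: cgamma].
move=> p t dpt c; pose c0 s := chart p (gamma s).
have [dc0 ddc0 eq0] := gammaP p (a * t) dpt.
have near_dom : \forall s \near t, dom p (gamma (a * s)).
  have ct : {for t, continuous (fun s => gamma (a * s))}.
    by apply: continuous_comp; [exact: mulrl_continuous|exact: cgamma].
  by apply: ct; apply: open_nbhs_nbhs; split => //; exact: dom_open.
have [dc c1] := derive1_mull dc0.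
have near_d : \forall s \near t, derivable c0 (a * s) 1.
  by apply: filterS near_dom => s /(gammaP p (a * s))[dc0s _ _]; exact: dc0s.
have [ddc c2] := derive1_mull2 near_d ddc0.
split; [exact: dc|exact: ddc|move=> k].
rewrite c2 c1 !mxE.
under eq_bigr => i _ do under eq_bigr => j _ do rewrite !mxE.
rewrite -[RHS](mulr0 (a ^+ 2)) -[X in _ = _ * X](eq0 k) mulrDr; congr (_ + _).
rewrite mulr_sumr; apply: eq_bigr => i _; rewrite mulr_sumr.
by apply: eq_bigr => j _; ring.
Qed.

(** The curve [s |-> gamma (t * s)] is a geodesic with initial velocity [t *: v], so its value at
    time 1 is [e x (t *: v)]. *)
Lemma exponential_map_geodesic (e : M -> 'rV[R]_n -> M) (x : M) (v : 'rV[R]_n) :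
  exponential_map g e ->
  exists gamma, [/\ geodesic g gamma, gamma 0 = x, velocity gamma 0 = v &
                    forall t, e x (t *: v) = gamma t].
Proof.
move=> /[dup] exp_e /(_ x v)[[gamma [geo gamma0 vel]] _].
exists gamma; split => // t.
have [_ /(_ (fun s => gamma (t * s)))] := exp_e x (t *: v).
rewrite mulr1; apply; split; [exact: geodesic_rescale|by rewrite mulr0|].
rewrite /velocity mulr0 -vel /velocity.
have [_ /(_ (gamma 0) 0 (dom_self _))[dc _ _]] := geo.
have := @derive1_mull _ (fun s => chart (gamma 0) (gamma s)) t 0.
by rewrite mulr0 => /(_ dc)[].
Qed.

Lemma gram_unitmx (x : M) : g x \in unitmx.
Proof.
rewrite -row_free_unit -kermx_eq0; apply/negPn/negP => /rowV0Pn[v].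
move=> /sub_kermxP vg0 /(gram_pos g x).
by rewrite vg0 mul0mx mxE ltxx.
Qed.

(** The inverse metric in [gradient] cancels the metric in [inner]; what remains is the differential
    of [h] in the chart around [x], expanded in the standard basis. *)
Lemma inner_gradient (h : M -> R) (x : M) (v : 'rV[R]_n) :
  differentiable (h \o param x) (chart x x) ->
  inner g x (gradient g h x) v = 'D_v (h \o param x) (chart x x).
Proof.
move=> dh; rewrite /inner /gradient mulmxKV ?gram_unitmx// mxE.
rewrite {2}(row_sum_delta v) deriveE// linear_sum; apply: eq_bigr => i _.
by rewrite linearZ/= -deriveE// !mxE mulrC.
Qed.

(** Chain rule along the geodesic [t |-> e x (t *: V x)], read in the chart around [x]. *)
Lemma cvg_grad_along (e : M -> 'rV[R]_n -> M) (h : M -> R)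
    (V : M -> 'rV[R]_n) (x : M) :
  exponential_map g e -> twice_differentiable h ->
  (h (e x (t *: V x)) - h x) / t @[t --> (0 : R)^'] --> grad_along g h V x.
Proof.
move=> /(@exponential_map_geodesic e x (V x))[gamma [geo g0 vel eg]] h2.
have [+ _] := h2 x => /(_ (chart x x)) dh.
have {}dh : differentiable (h \o param x) (chart x x).
  by apply: dh; exists x => //; exact: dom_self.
rewrite /grad_along inner_gradient//.
have [cgamma /(_ x 0)] := geo; rewrite g0 => /(_ (dom_self x))[dc _ _].
pose c s := chart x (gamma s); rewrite -/c in dc.
have c0 : c 0 = chart x x by rewrite /c g0.
have cv : derive1 c 0 = V x by rewrite -vel /velocity /c g0.
move/derivable1_diffP : dc => dc.
rewrite -c0 in dh *.
have dhc : differentiable ((h \o param x) \o c) 0 by exact: differentiable_comp.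
have D : 'D_1 ((h \o param x) \o c) 0 = 'D_(V x) (h \o param x) (c 0).
  by rewrite deriveE// diff_comp//= -derive1E'// cv deriveE.
pose F := (h \o param x) \o c.
have dF : (fun s => s^-1 *: ((F \o shift 0) (s *: 1) - F 0)) @ (0 : R)^' -->
    'D_1 F 0 by exact/derivable1_diffP.
move: dF; rewrite D; apply: cvg_trans; apply: near_eq_cvg.
have [cx _] := geo.
(* As long as the geodesic stays in the chart domain, [param x] undoes [chart x], so the quotient
   computed in the chart is that of [h] itself. *)
have near_dom : \forall s \near (0 : R)^', dom x (gamma s).
  apply: nbhs_dnbhs; apply: cx; apply: open_nbhs_nbhs.
  by split; [exact: dom_open|rewrite g0; exact: dom_self].
apply: filterS near_dom => t xt /=; rewrite eg.
rewrite /F /= addr0 -[(t *: 1)%R]/(t * 1) mulr1 /c g0 !chartK//.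
  exact: mulrC.
exact: dom_self.
Qed.
End Geodesics.

Lemma dist_le_cvg {R : realType} {T : Type} {F : set_system T} {FF : Filter F}
    (f b : T -> R) (l : R) :
  (forall t, `|f t - l| <= b t) -> b t @[t --> F] --> (0 : R) ->
  f t @[t --> F] --> l.
Proof.
move=> fb b0; apply/cvgrPdist_lt => eps eps0.
move/cvgrPdist_lt : b0 => /(_ eps eps0); apply: filterS => t.
rewrite sub0r normrN distrC; apply: le_lt_trans.
by rewrite (le_trans (fb t))// ler_norm.
Qed.

(** * Mean-square calculus: expectation and covariance on L^2 *)

Section MeanSquare.
Context {d : measure_display} {Om : measurableType d} {R : realType}.
Variable P : probability Om R.
Implicit Types X Y : Om -> R.

Lemma sqr_expectation_Lfun2 X : measurable_fun setT X ->
  ('E_P[fun w => (X w ^+ 2)%R] < +oo)%E -> X \in Lfun P 2%:E.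
Proof.
move=> mX; rewrite unlock => EX; rewrite inE; apply/andP; split; rewrite inE//=.
rewrite /finite_norm unlock /Lnorm poweR_lty//; apply: le_lt_trans EX.
rewrite le_eqVlt; apply/orP; left; apply/eqP; apply: eq_integral => w _ /=.
by rewrite powR_mulrn ?normr_ge0// real_normK ?num_real.
Qed.

Lemma Lfun2_measurable X : X \in Lfun P 2%:E -> measurable_fun setT X.
Proof. by move=> /sub_Lfun_mfun; rewrite inE. Qed.

Lemma Lfun21 X : X \in Lfun P 2%:E -> X \in Lfun P 1.
Proof. by apply: Lfun_subset12; exact: fin_num_measure. Qed.

Lemma Lfun2D X Y : X \in Lfun P 2%:E -> Y \in Lfun P 2%:E ->
  X \+ Y \in Lfun P 2%:E.
Proof. by move=> X2 Y2; rewrite rpredD// lee1n. Qed.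

Lemma Lfun2B X Y : X \in Lfun P 2%:E -> Y \in Lfun P 2%:E ->
  X \- Y \in Lfun P 2%:E.
Proof. by move=> X2 Y2; rewrite rpredB// lee1n. Qed.

Lemma Lfun2Z (a : R) X : X \in Lfun P 2%:E ->
  (fun w => a * X w) \in Lfun P 2%:E.
Proof.
move=> X2; rewrite (_ : (fun w => _) = a \o* X); last first.
  by apply/funext => w /=; rewrite mulrC.
by rewrite Lfun_scale// ler1n.
Qed.

(** Real-valued versions of the moments. Since [fine] sends infinite values to 0, they carry their
    usual meaning only for [X] and [Y] in L^2. *)
Definition mean X : R := fine 'E_P[X].
Definition cov X Y : R := fine (covariance P X Y).
Definition l2 X : R := Num.sqrt (fine 'E_P[fun w => (X w ^+ 2)%R]).

Lemma meanE X : X \in Lfun P 2%:E -> ('E_P[X] = (mean X)%:E)%E.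
Proof. by move=> /Lfun21 ?; rewrite fineK// expectation_fin_num. Qed.

Lemma covE X Y : X \in Lfun P 2%:E -> Y \in Lfun P 2%:E ->
  (covariance P X Y = (cov X Y)%:E)%E.
Proof.
move=> X2 Y2; rewrite fineK// covariance_fin_num//; try exact: Lfun21.
exact: Lfun2_mul_Lfun1.
Qed.

Lemma Lfun2_cst (c : R) : cst c \in Lfun P 2%:E.
Proof. exact: Lfun_cst. Qed.

Lemma mean_cst (c : R) : mean (cst c) = c.
Proof. by rewrite /mean expectation_cst. Qed.

Lemma meanB X Y : X \in Lfun P 2%:E -> Y \in Lfun P 2%:E ->
  mean (X \- Y) = mean X - mean Y.
Proof.
move=> X2 Y2; apply: EFin_inj; rewrite EFinB -!meanE ?Lfun2B//.
by rewrite expectationB//; exact: Lfun21.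
Qed.

Lemma meanZ (a : R) X : X \in Lfun P 2%:E ->
  mean (fun w => a * X w) = a * mean X.
Proof.
move=> X2; apply: EFin_inj; rewrite EFinM -!meanE ?Lfun2Z//.
rewrite -expectationZl; last exact: Lfun21.
by congr expectation; apply/funext => w /=; rewrite mulrC.
Qed.

Lemma sqr_l2 X : X \in Lfun P 2%:E ->
  ('E_P[fun w => (X w ^+ 2)%R] = (l2 X ^+ 2)%:E)%E.
Proof.
move=> X2; have E0 : (0 <= 'E_P[fun w => (X w ^+ 2)%R])%E.
  by apply: expectation_ge0 => w; exact: sqr_ge0.
rewrite /l2 sqr_sqrtr ?fine_ge0// fineK//.
by apply: expectation_fin_num; apply/Lfun1_integrable/Lfun2_integrable_sqr.
Qed.

Lemma cov_diag X : X \in Lfun P 2%:E -> cov X X = l2 X ^+ 2 - mean X ^+ 2.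
Proof.
move=> X2; apply: EFin_inj.
rewrite -covE// -[LHS]/('V_P[X])%E varianceE// EFinB -sqr_l2//.
by rewrite (meanE X2).
Qed.

Lemma cov_ge0 X : 0 <= cov X X.
Proof. by rewrite fine_ge0// (variance_ge0 P X). Qed.

(** The variance [l2 X ^+ 2 - mean X ^+ 2] is nonnegative. *)
Lemma ler_mean_l2 X : X \in Lfun P 2%:E -> `|mean X| <= l2 X.
Proof.
move=> X2; rewrite -[leRHS]ger0_norm ?sqrtr_ge0// -ler_sqr ?nnegrE//.
by rewrite !real_normK ?num_real// -subr_ge0 -cov_diag// cov_ge0.
Qed.

Lemma covC X Y : cov X Y = cov Y X.
Proof. by rewrite /cov covarianceC. Qed.

Lemma covBl X Y Z : X \in Lfun P 2%:E -> Y \in Lfun P 2%:E ->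
  Z \in Lfun P 2%:E -> cov (X \- Y) Z = cov X Z - cov Y Z.
Proof.
move=> X2 Y2 Z2; apply: EFin_inj.
by rewrite EFinB -!covE ?covarianceBl// Lfun2B.
Qed.

Lemma covBr X Y Z : X \in Lfun P 2%:E -> Y \in Lfun P 2%:E ->
  Z \in Lfun P 2%:E -> cov Z (X \- Y) = cov Z X - cov Z Y.
Proof. by move=> X2 Y2 Z2; rewrite covC covBl// ![cov _ Z]covC. Qed.

Lemma covZl (a : R) X Y : X \in Lfun P 2%:E -> Y \in Lfun P 2%:E ->
  cov (fun w => a * X w) Y = a * cov X Y.
Proof.
move=> X2 Y2.
have -> : (fun w => a * X w) = a \o* X by apply/funext => w /=; rewrite mulrC.
apply: EFin_inj; rewrite EFinM -!covE ?covarianceZl//.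
- exact: Lfun21.
- exact: Lfun21.
- exact: Lfun2_mul_Lfun1.
- by rewrite Lfun_scale// ler1n.
Qed.

Lemma l2_ge0 X : 0 <= l2 X. Proof. exact: sqrtr_ge0. Qed.

Lemma l2Z (a : R) X : X \in Lfun P 2%:E -> l2 (fun w => a * X w) = `|a| * l2 X.
Proof.
move=> X2; apply/eqP; rewrite -(@eqrXn2 _ 2)// ?mulr_ge0 ?l2_ge0//.
have aX2 : (fun w => a * X w) \in Lfun P 2%:E.
  exact: Lfun2Z.
apply/eqP/EFin_inj; rewrite -sqr_l2// exprMn real_normK ?num_real// EFinM.
rewrite -sqr_l2// -expectationZl.
  by congr expectation; apply/funext => w /=; rewrite exprMn mulrC.
exact/Lfun1_integrable/Lfun2_integrable_sqr.
Qed.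

(** Cauchy-Schwarz bounds a covariance by the product of standard deviations, and these are at most
    the L^2 norms. *)
Lemma ler_norm_cov X Y : X \in Lfun P 2%:E -> Y \in Lfun P 2%:E ->
  `|cov X Y| <= l2 X * l2 Y.
Proof.
move=> X2 Y2.
(* A one-sided bound for any [Y'] of the same norm as [Y]; taking [Y'] to be [Y] and then its
   opposite bounds the absolute value. *)
have covP Y' : Y' \in Lfun P 2%:E -> l2 Y' = l2 Y -> cov X Y' <= l2 X * l2 Y.
  move=> Y'2 <-; have := covariance_le X2 Y'2.
  rewrite /variance !covE//= -EFinM lee_fin => /le_trans; apply.
  have sd W : W \in Lfun P 2%:E -> Num.sqrt (cov W W) <= l2 W.
    move=> W2; rewrite -[leRHS]ger0_norm ?l2_ge0// -sqrtr_sqr ler_wsqrtr//.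
    by rewrite cov_diag// gerBl sqr_ge0.
  by rewrite ler_pM ?sqrtr_ge0// sd.
rewrite ler_norml covP// andbT lerNl.
have -> : - cov X Y = cov X (fun w => (-1) * Y w).
  by rewrite [RHS]covC covZl// mulN1r covC.
apply: covP; last by rewrite l2Z// normrN1 mul1r.
exact: Lfun2Z.
Qed.

(** A crude triangle inequality, from [(x + y)^2 <= 2 x^2 + 2 y^2]; the constant is harmless for
    convergence to 0. *)
Lemma ler_l2D X Y : X \in Lfun P 2%:E -> Y \in Lfun P 2%:E ->
  l2 (X \+ Y) <= 2 * (l2 X + l2 Y).
Proof.
move=> X2 Y2; have XY2 : X \+ Y \in Lfun P 2%:E by exact: Lfun2D.
rewrite -ler_sqr ?nnegrE ?mulr_ge0 ?addr_ge0 ?l2_ge0//.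
suff le2 : l2 (X \+ Y) ^+ 2 <= 2 * l2 X ^+ 2 + 2 * l2 Y ^+ 2.
  have := l2_ge0 X; have := l2_ge0 Y; nra.
have sq1 W : W \in Lfun P 2%:E -> (fun w => W w ^+ 2) \in Lfun P 1.
  by move=> W2; exact/Lfun1_integrable/Lfun2_integrable_sqr.
suff : ((l2 (X \+ Y) ^+ 2)%:E <=
    2%:E * (l2 X ^+ 2)%:E + 2%:E * (l2 Y ^+ 2)%:E)%E.
  by rewrite -!EFinM -EFinD lee_fin.
rewrite -!sqr_l2// -!expectationZl ?sq1//.
rewrite -expectationD; last 2 first.
- by rewrite Lfun_scale ?ler1n// sq1.
- by rewrite Lfun_scale ?ler1n// sq1.
have [mX mY] := (Lfun2_measurable X2, Lfun2_measurable Y2).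
apply: expectation_le => [||w|w|].
- by apply: measurable_funX; exact: measurable_funD.
- by apply: measurable_funD; apply: measurable_funM => //;
    exact: measurable_funX.
- exact: sqr_ge0.
- by rewrite /= addr_ge0// mulr_ge0// sqr_ge0.
- apply: aeW => w /=; rewrite -subr_ge0.
  by rewrite (_ : _ - _ = (X w - Y w) ^+ 2) ?sqr_ge0//; ring.
Qed.

(** Chebyshev's inequality without centering: Markov's inequality for the square. *)
Lemma probability_ge_l2 X (eps : R) : X \in Lfun P 2%:E -> 0 < eps ->
  (P [set w | (eps <= `|X w|)%R] <= ((l2 X / eps) ^+ 2)%:E)%E.
Proof.
move=> X2 eps0; have mX := Lfun2_measurable X2.
rewrite expr_div_n EFinM muleC -lee_pdivrMl ?invr_gt0 ?exprn_gt0//.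
rewrite invrK -sqr_l2//.
pose X' := mfun_Sub (sub_Lfun_mfun X2).
have := @markov _ _ _ P X' (fun r => r ^+ 2) eps eps0.
rewrite (_ : _ \o _ = fun w => X w ^+ 2); last first.
  by apply/funext => w /=; rewrite real_normK ?num_real.
apply => [|r _|x y x0 y0 xy]; [exact: measurable_funX|exact: sqr_ge0|].
by rewrite ler_sqr.
Qed.

Section Limits.
Context {I : Type} {F : set_system I}.

Lemma cvg_l2 {FF : Filter F} (X_ : I -> Om -> R) X :
  'E_P[fun w => ((X_ i w - X w) ^+ 2)%R]%E @[i --> F] --> (0%:E : \bar R) ->
  l2 (X_ i \- X) @[i --> F] --> (0 : R).
Proof.
move=> /fine_cvg E0; rewrite -[0]sqrtr0.
apply: (cvg_comp _ _ E0); exact: sqrt_continuous.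
Qed.

(** Convergence makes some [X_ i \- X] square integrable, and [X] is the difference of [X_ i] and
    it. *)
Lemma ms_limit_Lfun2 {FF : ProperFilter F} (X_ : I -> Om -> R) X :
  (forall i, X_ i \in Lfun P 2%:E) -> measurable_fun setT X ->
  'E_P[fun w => ((X_ i w - X w) ^+ 2)%R]%E @[i --> F] --> (0%:E : \bar R) ->
  X \in Lfun P 2%:E.
Proof.
move=> X_2 mX /cvg_is_fine/filter_ex[i fin].
have -> : X = X_ i \- (X_ i \- X) by apply/funext => w /=; rewrite subKr.
apply: Lfun2B => //; apply: sqr_expectation_Lfun2.
  by apply: measurable_funB => //; exact: Lfun2_measurable.
by rewrite ltey_eq fin.
Qed.

Lemma cvg_mean {FF : Filter F} (X_ : I -> Om -> R) X :
  (forall i, X_ i \in Lfun P 2%:E) -> X \in Lfun P 2%:E ->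
  l2 (X_ i \- X) @[i --> F] --> (0 : R) -> mean (X_ i) @[i --> F] --> mean X.
Proof.
move=> X_2 X2; apply: dist_le_cvg => i.
by rewrite -meanB//; apply: ler_mean_l2; exact: Lfun2B.
Qed.

(** The two arguments run along independent filters, as the two increments of a mixed difference
    quotient do. *)
Lemma cvg_cov {J : Type} {G : set_system J} {FF : Filter F} {FG : Filter G}
    (X_ : I -> Om -> R) (Y_ : J -> Om -> R) X Y :
  (forall i, X_ i \in Lfun P 2%:E) -> X \in Lfun P 2%:E ->
  (forall j, Y_ j \in Lfun P 2%:E) -> Y \in Lfun P 2%:E ->
  l2 (X_ i \- X) @[i --> F] --> (0 : R) ->
  l2 (Y_ j \- Y) @[j --> G] --> (0 : R) ->
  cov (X_ ij.1) (Y_ ij.2) @[ij --> filter_prod F G] --> cov X Y.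
Proof.
move=> X_2 X2 Y_2 Y2 lX lY.
have {}lX : l2 (X_ ij.1 \- X) @[ij --> filter_prod F G] --> (0 : R).
  by apply: cvg_comp lX; exact: cvg_fst.
have {}lY : l2 (Y_ ij.2 \- Y) @[ij --> filter_prod F G] --> (0 : R).
  by apply: cvg_comp lY; exact: cvg_snd.
(* With errors [A] and [B], bilinearity splits the difference of covariances into
   [cov A B + cov A Y + cov X B]; [b] bounds these terms by [ler_norm_cov]. *)
pose b ij := l2 (X_ ij.1 \- X) * (l2 (Y_ ij.2 \- Y) + l2 Y)
             + l2 X * l2 (Y_ ij.2 \- Y).
have b0 : b ij @[ij --> filter_prod F G] --> (0 : R).
  rewrite -(mul0r (0 + l2 Y)) -[X in _ --> X]addr0 -[X in _ + X](mulr0 (l2 X)).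
  apply: cvgD; apply: cvgM => //; last exact: cvg_cst.
  by apply: cvgD => //; exact: cvg_cst.
apply: dist_le_cvg b0 => ij; rewrite /b.
set A := X_ ij.1 \- X; set B := Y_ ij.2 \- Y.
have A2 : A \in Lfun P 2%:E by exact: Lfun2B.
have B2 : B \in Lfun P 2%:E by exact: Lfun2B.
have -> : cov (X_ ij.1) (Y_ ij.2) - cov X Y = cov A B + cov A Y + cov X B.
  by rewrite !covBr// !covBl//; ring.
rewrite mulrDr (le_trans (ler_normD _ _))// lerD ?ler_norm_cov//.
by rewrite (le_trans (ler_normD _ _))// lerD ?ler_norm_cov.
Qed.

End Limits.
End MeanSquare.

(** * Tails of normal laws *)

Section NormalLaw.
Context {R : realType}.

(** Closed upper half-lines are stable under intersection and generate the Borel sets. *)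
Lemma eq_probability_itvcy (m1 m2 : probability (measurableTypeR R) R) :
  (forall x : R, m1 `[x, +oo[%classic = m2 `[x, +oo[%classic) ->
  forall A, measurable A -> m1 A = m2 A.
Proof.
move=> m12 A mA.
apply: (@measure_unique _ R (measurableTypeR R) (@RGenCInfty.G R)
   (fun k => `[- k%:R, +oo[%classic)) => //.
- exact: RGenCInfty.measurableE.
- move=> _ _ [x ->] [y ->]; exists (Num.max x y).
  by apply/seteqP; split => z /=; rewrite !in_itv/= !andbT ge_max => /andP.
- by move=> k; exists (- k%:R).
- apply/seteqP; split => // x _; exists (Num.truncn `|x|).+1 => //=.
  rewrite in_itv/= andbT lerNl (le_trans (ler_norm _))// normrN ltW//.
  by rewrite truncnS_gt.
- by move=> _ [x ->]; exact: m12.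
- by move=> k; rewrite (le_lt_trans (probability_le1 _ _)) ?ltry.
Qed.

Definition gaussian_tail (z : R) : R :=
  fine (normal_prob 0 1 `[z, +oo[%classic).

Lemma normal_pdf_std (m s x : R) : 0 < s ->
  normal_pdf m s x = normal_pdf 0 1 ((x - m) / s) / s.
Proof.
move=> s0; rewrite !normal_pdfE ?oner_neq0 ?gt_eqF//.
have -> : normal_peak s = normal_peak 1 / s.
  rewrite /normal_peak -mulrnAr sqrtrM ?sqr_ge0// sqrtr_sqr gtr0_norm//.
  by rewrite invfM mulrC expr1n mul1r.
have -> : normal_fun m s x = normal_fun 0 1 ((x - m) / s).
  by congr expR; rewrite subr0 expr1n; field; rewrite gt_eqF.
by rewrite mulrAC.
Qed.

(** Integration by the substitution [x |-> (x - m) / s], whose derivative is the constant [s^-1]. *)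
Lemma normal_prob_itvcy (m s r : R) : 0 < s ->
  normal_prob m s `[r, +oo[%classic = (gaussian_tail ((r - m) / s))%:E.
Proof.
move=> s0; rewrite /gaussian_tail fineK; last exact: fin_num_measure.
rewrite /normal_prob.
pose F x : R := (x - m) / s.
have dF (x : R) : is_derive x 1 F s^-1.
  rewrite /F; apply: is_derive_eq.
  by rewrite subr0 scaler0 add0r -[LHS]/(s^-1 * 1) mulr1.
have F'E : F^`()%classic = cst s^-1.
  by apply/funext => x; rewrite derive1E derive_val.
have FP : (forall x, continuous_at x F).
  move=> x; apply: differentiable_continuous; apply/derivable1_diffP.
  exact: ex_derive.
rewrite -/(F r) (@increasing_ge0_integration_by_substitutiony _ F)//.
- apply: eq_integral => x _; congr EFin.
  by rewrite F'E fctE/= normal_pdf_std.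
- by move=> x y _ _ xy; rewrite ltr_pM2r ?invr_gt0// ltrD2r.
- by rewrite F'E => ? _; exact: cvg_cst.
- by rewrite F'E; exact: is_cvg_cst.
- by rewrite F'E; exact: is_cvg_cst.
- split; first by move=> x _; exact: ex_derive.
  by apply: cvg_at_right_filter; exact: FP.
- by apply/gt0_cvgMly; [rewrite invr_gt0|exact: cvg_addrr].
- by apply/continuous_subspaceT/continuous_normal_pdf; exact: oner_neq0.
- by move=> x _; exact: normal_pdf_ge0.
Qed.

(** The difference of tails is the mass of the interval between [a] and [b], and the density is at
    most [normal_peak 1]. *)
Lemma gaussian_tail_lip (a b : R) :
  `|gaussian_tail a - gaussian_tail b| <= normal_peak 1 * `|a - b|.
Proof.
wlog ab : a b / a <= b.
  move=> h; have [/h//|/ltW/h] := leP a b.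
  by rewrite distrC [in leRHS]distrC.
have mab : normal_prob 0 1 `[a, b[%classic =
    (gaussian_tail a - gaussian_tail b)%:E.
  rewrite EFinB !fineK ?fin_num_measure//.
  rewrite (_ : `[a, b[%classic = `[a, +oo[%classic `\` `[b, +oo[%classic);
    last first.
    apply/seteqP; split => x /=; rewrite !in_itv/= !andbT.
      by move=> /andP[-> xb]; split => //; apply/negP; rewrite -ltNge.
    by move=> [-> /negP]; rewrite -ltNge.
  rewrite measureD ?setIidr//.
    by move=> x /=; rewrite !in_itv/= !andbT; exact: le_trans.
  by rewrite (le_lt_trans (probability_le1 _ _)) ?ltry.
have ge0 : 0 <= gaussian_tail a - gaussian_tail b.
  by rewrite -lee_fin -mab measure_ge0.
rewrite ger0_norm// -lee_fin -mab ler0_norm ?subr_le0// opprB.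
rewrite /normal_prob.
apply: (@le_trans _ _
  (\int[lebesgue_measure]_(x in `[a, b[) (normal_peak 1)%:E)%E).
  apply: ge0_le_integral => //.
  - by move=> x _; rewrite lee_fin normal_pdf_ge0.
  - by apply/measurable_EFinP/measurable_funTS; exact: measurable_normal_pdf.
  - by move=> x _; rewrite lee_fin normal_pdf_ub.
rewrite integral_cst//= lebesgue_measure_itv/= lte_fin.
case: ifPn => [_|]; first by rewrite -EFinB -EFinM.
by rewrite mule0 lee_fin mulr_ge0 ?normal_peak_ge0 ?subr_ge0.
Qed.

Lemma continuous_gaussian_tail : continuous gaussian_tail.
Proof.
move=> a.
have d0 : normal_peak 1 * `|b - a| @[b --> a] --> (0 : R).
  rewrite -[X in _ --> X](mulr0 (normal_peak 1)).
  apply: cvgM; first exact: cvg_cst.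
  have /(_ a) : continuous (fun b : R => `|b - a|).
    move=> b; apply: (@continuous_comp _ _ _ (fun b => b - a) Num.norm).
      by apply: continuousB; [exact: cvg_id|exact: cst_continuous].
    exact: norm_continuous.
  by rewrite /continuous_at subrr normr0.
by apply: dist_le_cvg d0 => b; exact: gaussian_tail_lip.
Qed.
End NormalLaw.

(** * Location and scale of a normal variable *)

Section GaussianLimits.
Context {d : measure_display} {Om : measurableType d} {R : realType}.
Variable P : probability Om R.
Implicit Types X Y : Om -> R.

(* [measurableTypeR R] is [R] with the display for which the library defines the
   Lebesgue measure, hence also [normal_prob]. *)
Definition rv_of X (mX : measurable_fun setT X) :
    {mfun Om >-> measurableTypeR R} :=
  mfun_Sub (mem_set (mX : measurable_fun setT (X : Om -> measurableTypeR R))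
    : (X : Om -> measurableTypeR R) \in mfun).

Lemma eq_law_itvcy X (mu : probability (measurableTypeR R) R) :
  measurable_fun setT X ->
  (forall r : R, P (X @^-1` `[r, +oo[%classic) = mu `[r, +oo[%classic) ->
  forall A, measurable A -> P (X @^-1` A) = mu A.
Proof.
move=> mX Xmu A mA.
exact: (@eq_probability_itvcy _ (distribution P (rv_of mX)) mu).
Qed.

Definition std_mean : R := fine (\int[@normal_prob R 0 1]_x (x : R)%:E).
Definition std_var : R :=
  fine (\int[@normal_prob R 0 1]_x ((x - std_mean : R) ^+ 2)%:E).

(** Both moments are integrals against the law of [X], by change of variables. *)
Lemma std_moments X : X \in Lfun P 2%:E ->
  (forall A, measurable A -> P (X @^-1` A) = normal_prob 0 1 A) ->
  mean P X = std_mean /\ cov P X X = std_var.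
Proof.
move=> X2 XN; have mX := Lfun2_measurable X2.
have EX : mean P X = std_mean.
  rewrite /mean /std_mean unlock; congr fine.
  transitivity (\int[distribution P (rv_of mX)]_y (y : R)%:E)%E.
    rewrite integral_distribution//.
    exact/Lfun1_integrable/Lfun21.
  by apply: eq_measure_integral => A mA _; exact: XN.
split => //; rewrite /cov /std_var unlock -/(mean P X) EX unlock; congr fine.
transitivity (\int[distribution P (rv_of mX)]_y ((y - std_mean : R) ^+ 2)%:E)%E.
  rewrite ge0_integral_distribution//.
    apply/measurable_EFinP/measurable_funX/measurable_funB => //.
  by move=> y; rewrite lee_fin sqr_ge0.
by apply: eq_measure_integral => A mA _; exact: XN.
Qed.

(** Positive variance excludes a point mass; otherwise [(X - m) / s] is standard normal and its
    moments are transported back to [X]. *)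
Lemma normal_variable_nondeg X : X \in Lfun P 2%:E -> 0 < cov P X X ->
  normal_variable P X -> exists m s : R, [/\ 0 < s,
    (forall r : R, P (X @^-1` `[r, +oo[%classic) =
                   (gaussian_tail ((r - m) / s))%:E),
    mean P X = m + s * std_mean & cov P X X = s ^+ 2 * std_var].
Proof.
move=> X2 covX; have mX := Lfun2_measurable X2.
case=> [[m [s [s0 XN]]]|[m Xm]]; last first.
  (* Point-mass case: [X] is almost surely [m], so its variance is [m ^+ 2 - m ^+ 2], against
     [covX]. *)
  have mXm : measurable (X @^-1` [set m]).
    by rewrite -[X in measurable X]setTI; exact: mX.
  have X_m : {ae P, forall w, X w = m}.
    exists (X @^-1` (~` [set m])); split => //.
    - exact: measurableC.
    - by rewrite Xm ?diracE ?memNset//; [apply; []|exact: measurableC].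
  move: covX; rewrite cov_diag//.
  have -> : l2 P X ^+ 2 = m ^+ 2.
    apply: EFin_inj; rewrite -sqr_l2// unlock.
    rewrite (ae_eq_integral (cst (m ^+ 2)%:E))//.
    - by rewrite integral_cst//= probability_setT mule1.
    - by apply/measurable_EFinP/measurable_funX.
    - by apply: filterS X_m => w -> _.
  have -> : mean P X = m.
    apply: EFin_inj; rewrite -meanE// unlock.
    rewrite (ae_eq_integral (cst m%:E))//.
    - by rewrite integral_cst//= probability_setT mule1.
    - exact/measurable_EFinP.
    - by apply: filterS X_m => w -> _.
  by rewrite subrr ltxx.
exists m, s.
have tailX r : P (X @^-1` `[r, +oo[%classic) =
    (gaussian_tail ((r - m) / s))%:E.
  by rewrite XN// normal_prob_itvcy.
pose W w := s^-1 * (X \- cst m) w.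
have c2 : cst m \in Lfun P 2%:E by exact: Lfun2_cst.
have Xm2 : X \- cst m \in Lfun P 2%:E by exact: Lfun2B.
have W2 : W \in Lfun P 2%:E by exact: Lfun2Z.
have [|mW cW] := std_moments W2.
  apply: (eq_law_itvcy (Lfun2_measurable W2)) => r.
  rewrite (_ : _ @^-1` _ = X @^-1` `[m + s * r, +oo[%classic).
    rewrite tailX; apply: etrans (esym (normal_prob_itvcy 0 r ltr01)).
    by congr (gaussian_tail _)%:E; field; rewrite gt_eqF.
  apply/seteqP; split => w; rewrite /= !in_itv/= !andbT /W -lerBrDl.
    by rewrite [in X in X -> _]mulrC ler_pdivlMr// mulrC.
  by rewrite [in X in _ -> X]mulrC ler_pdivlMr// mulrC.
have XW : X = (fun w => s * W w) \- cst (- m).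
  by apply/funext => w; rewrite /W/= opprK mulrA divff ?gt_eqF// mul1r subrK.
have cm2 : cst (- m) \in Lfun P 2%:E by exact: Lfun2_cst.
have sW2 : (fun w => s * W w) \in Lfun P 2%:E by exact: Lfun2Z.
have cov0 Y : cov P (cst (- m)) Y = 0 by rewrite /cov covariance_cst_l.
split => //; rewrite XW.
  by rewrite meanB// meanZ// mean_cst mW opprK addrC.
rewrite covBl// ?Lfun2B// cov0 subr0 covBr// [cov _ _ (cst _)]covC cov0 subr0.
by rewrite covZl// covC covZl// cW mulrA -expr2.
Qed.
End GaussianLimits.

(** * Normality of mean-square limits *)

Section GaussianLimit.
Context {d : measure_display} {Om : measurableType d} {R : realType}.
Variable P : probability Om R.
Implicit Types X Y : Om -> R.

Lemma normal_variable_cov0 X : X \in Lfun P 2%:E -> cov P X X = 0 ->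
  normal_variable P X.
Proof.
move=> X2 cX0; right; exists (mean P X); set m := mean P X => A mA.
have mX := Lfun2_measurable X2.
have X_m : {ae P, forall w, X w = m}.
  (* The square of [X - m] is nonnegative with integral 0, hence almost surely 0. *)
  have /ae_eq_integral_abs/= /(_ P measurableT) [+ _] :
      measurable_fun setT (fun w => ((X w - m) ^+ 2)%:E).
    by apply/measurable_EFinP/measurable_funX/measurable_funB.
  have -> : (\int[P]_w `|((X w - m) ^+ 2)%:E| = 0)%E.
    rewrite -[RHS]/(0%:E) -cX0 -covE// unlock -/(mean P X) -/m unlock.
    apply: eq_integral => w _ /=; by rewrite ger0_norm ?sqr_ge0.
  move=> /(_ erefl); apply: filterS => w /(_ Logic.I)[] /eqP.
  by rewrite sqrf_eq0 subr_eq0 => /eqP.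
have mXA : measurable (X @^-1` A).
  by rewrite -[X in measurable X]setTI; exact: mX.
rewrite -[X @^-1` A]setIT -integral_indic//.
rewrite (ae_eq_integral (cst (\1_A m)%:E))//.
- by rewrite integral_cst//= probability_setT mule1.
- exact/measurable_EFinP.
- by apply: filterS X_m => w Xw _; rewrite /= !indicE -Xw.
Qed.

Lemma l2BC X Y : l2 P (X \- Y) = l2 P (Y \- X).
Proof.
by congr (Num.sqrt (fine 'E_P[_])); apply/funext => w /=; ring.
Qed.

(** If [X] is at least [r], then [Y] is at least [r - eps] or the two differ by at least [eps];
    Chebyshev controls the second event. *)
Lemma probability_itvcy_le X Y (r eps : R) :
  X \in Lfun P 2%:E -> Y \in Lfun P 2%:E -> 0 < eps ->
  (P (X @^-1` `[r, +oo[) <=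
   P (Y @^-1` `[(r - eps)%R, +oo[) + ((l2 P (Y \- X) / eps) ^+ 2)%:E)%E.
Proof.
move=> X2 Y2 eps0; have YX2 := Lfun2B Y2 X2.
have mpre Z a : Z \in Lfun P 2%:E -> measurable (Z @^-1` `[a, +oo[%classic).
  move=> /Lfun2_measurable mZ; rewrite -[X in measurable X]setTI.
  by apply: mZ => //; exact: measurable_itv.
have mE : measurable [set w | eps <= `|(Y \- X) w|].
  have mYX := Lfun2_measurable YX2.
  have -> : [set w | eps <= `|(Y \- X) w|] =
      [set: Om] `&` (Num.norm \o (Y \- X)) @^-1` `[eps, +oo[%classic.
    by apply/seteqP; split => w /=; rewrite in_itv/= andbT => // -[].
  have mN : measurable_fun setT (Num.norm \o (Y \- X)).
    exact: measurableT_comp.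
  exact: (mN measurableT _ (measurable_itv `[eps, +oo[)).
apply: le_trans (leeD2l _ (probability_ge_l2 YX2 eps0)).
apply: le_trans (measureU2 _ _ _); [|exact: mpre|exact: mE].
apply: le_measure; rewrite ?inE; [exact: mpre|apply: measurableU => //|].
  exact: mpre.
move=> w /=; rewrite !in_itv/= !andbT => rX.
have [|lt] := leP (r - eps) (Y w); [by left|right].
rewrite distrC ler_normr; apply/orP; left; lra.
Qed.

(** In the nondegenerate case the tail of [X] at [r] is squeezed between limits of tails of [X_ i]
    at [r + eps] and [r - eps]; then [eps] tends to 0. *)
Lemma normal_variable_ms_limit {I : Type} {F : set_system I}
    {FF : ProperFilter F} (X_ : I -> Om -> R) X :
  (forall i, X_ i \in Lfun P 2%:E) -> X \in Lfun P 2%:E ->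
  (forall i, normal_variable P (X_ i)) ->
  l2 P (X_ i \- X) @[i --> F] --> (0 : R) -> normal_variable P X.
Proof.
move=> X_2 X2 nX_ X_X.
have [cX0|cXn0] := eqVneq (cov P X X) 0; first exact: normal_variable_cov0.
have cX0 : 0 < cov P X X by rewrite lt_neqAle eq_sym cXn0 cov_ge0.
have cX : cov P (X_ i) (X_ i) @[i --> F] --> cov P X X.
  (* Variances are covariances restricted to the diagonal. *)
  have dF : (i, i) @[i --> F] --> filter_prod F F by exact: cvg_pair.
  exact: (cvg_comp _ _ dF (cvg_cov X_2 X2 X_2 X2 X_X X_X)).
have mX : mean P (X_ i) @[i --> F] --> mean P X by exact: cvg_mean.
have nd : \forall i \near F, 0 < cov P (X_ i) (X_ i).
  exact: (cvgr_gt _ cX).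
(* Read off from a single nondegenerate [X_ i], whose positive variance is [s ^+ 2 * std_var]. *)
have v0 : 0 < @std_var R.
  have [i ci] := filter_ex nd.
  have [_ [s [s0 _ _ cE]]] := normal_variable_nondeg (X_2 i) ci (nX_ i).
  by move: ci; rewrite cE pmulr_rgt0// exprn_gt0.
(* [sd] and [loc] recover the parameters [s] and [m] of a normal variable from its variance and
   mean, hence pass to the limit. *)
pose sd Y := Num.sqrt (cov P Y Y / std_var).
pose loc Y := mean P Y - sd Y * std_mean.
have sX0 : 0 < sd X by rewrite sqrtr_gt0 divr_gt0.
have sX : sd (X_ i) @[i --> F] --> sd X.
  have cXv : cov P (X_ i) (X_ i) / std_var @[i --> F] --> cov P X X / std_var.
    by apply: cvgM => //; exact: cvg_cst.
  exact: (cvg_comp _ _ cXv (@sqrt_continuous _ _)).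
have lX : loc (X_ i) @[i --> F] --> loc X.
  have sc : sd (X_ i) * std_mean @[i --> F] --> sd X * std_mean.
    by apply: cvgM => //; exact: cvg_cst.
  exact: cvgB mX sc.
have tailE Y : Y \in Lfun P 2%:E -> 0 < cov P Y Y -> normal_variable P Y ->
    forall r : R, P (Y @^-1` `[r, +oo[%classic) =
                  (gaussian_tail ((r - loc Y) / sd Y))%:E.
  move=> Y2 cY nY r.
  have [m [s [s0 -> mE cE]]] := normal_variable_nondeg Y2 cY nY.
  have sE : sd Y = s.
    by rewrite /sd cE mulfK ?gt_eqF// sqrtr_sqr gtr0_norm.
  by rewrite /loc sE mE addrK.
have tail_cvg r : gaussian_tail ((r - loc (X_ i)) / sd (X_ i)) @[i --> F] -->
    gaussian_tail ((r - loc X) / sd X).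
  have : (r - loc (X_ i)) / sd (X_ i) @[i --> F] --> (r - loc X) / sd X.
    apply: cvgM; first by apply: cvgB => //; exact: cvg_cst.
    by apply: cvgV => //; rewrite gt_eqF.
  by move=> /cvg_comp; apply; exact: continuous_gaussian_tail.
have err eps : 0 < eps -> (l2 P (X_ i \- X) / eps) ^+ 2 @[i --> F] --> (0 : R).
  move=> eps0.
  have : l2 P (X_ i \- X) / eps @[i --> F] --> (0 : R).
    by rewrite -(mul0r (eps^-1)); apply: cvgM => //; exact: cvg_cst.
  by move=> lE; rewrite -(mulr0 0); exact: cvgM.
pose p r := fine (P (X @^-1` `[r, +oo[%classic)).
have pE r : P (X @^-1` `[r, +oo[%classic) = (p r)%:E.
  by rewrite fineK// fin_num_measure// -[X in measurable X]setTI;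
    apply: (Lfun2_measurable X2) => //; exact: measurable_itv.
have p_le r eps : 0 < eps -> p r <= gaussian_tail ((r - eps - loc X) / sd X).
  move=> eps0; rewrite -[leRHS]addr0.
  apply: (cvgr_to_ge (cvgD (tail_cvg (r - eps)) (err eps eps0))).
  apply: filterS nd => i ci.
  by rewrite -lee_fin EFinD -pE -tailE//; exact: probability_itvcy_le.
have p_ge r eps : 0 < eps -> gaussian_tail ((r + eps - loc X) / sd X) <= p r.
  move=> eps0; rewrite -[leLHS]subr0.
  apply: (cvgr_to_le (cvgB (tail_cvg (r + eps)) (err eps eps0))).
  apply: filterS nd => i ci; rewrite lerBlDr.
  rewrite -lee_fin EFinD -pE -tailE// l2BC.
  rewrite -[in X in (_ <= P X + _)%E](addrK eps r).
  exact: probability_itvcy_le.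
(* The boolean selects the sign of [eps]: minus for [true], plus for [false]. *)
have tail_cont r (b : bool) :
    gaussian_tail ((r + (-1) ^+ b * eps - loc X) / sd X) @[eps --> 0^'+] -->
    gaussian_tail ((r - loc X) / sd X).
  have : (r + (-1) ^+ b * eps - loc X) / sd X @[eps --> 0^'+] -->
      (r + (-1) ^+ b * 0 - loc X) / sd X.
    apply: cvgM; last exact: cvg_cst.
    apply: cvgB; last exact: cvg_cst.
    apply: cvgD; first exact: cvg_cst.
    apply: cvgM; first exact: cvg_cst.
    by apply: cvg_at_right_filter; exact: cvg_id.
  by rewrite mulr0 addr0 => /cvg_comp; apply; exact: continuous_gaussian_tail.
left; exists (loc X), (sd X); split => //.
apply: (eq_law_itvcy (Lfun2_measurable X2)) => r.
rewrite pE; apply: etrans (esym (normal_prob_itvcy (loc X) r sX0)); congr EFin.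
apply/eqP; rewrite eq_le; apply/andP; split.
  apply: (cvgr_to_ge (tail_cont r true)); near=> eps.
  by rewrite expr1 mulN1r p_le.
apply: (cvgr_to_le (tail_cont r false)); near=> eps.
by rewrite expr0 mul1r p_ge.
Unshelve. all: by end_near. Qed.
End GaussianLimit.

(** * Derivative processes of Gaussian processes *)

Section DerivativeProcess.
Context {d : measure_display} {Om : measurableType d} {R : realType}.
Variable P : probability Om R.

Lemma Lfun2_sum {J : Type} (r : seq J) (a : J -> R) (X : J -> Om -> R) :
  (forall j, X j \in Lfun P 2%:E) ->
  (fun w => \sum_(j <- r) a j * X j w) \in Lfun P 2%:E.
Proof.
move=> X2; elim: r => [|j r IH].
  rewrite (_ : (fun _ => _) = cst 0) ?Lfun2_cst//.
  by apply/funext => w; rewrite big_nil.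
rewrite (_ : (fun _ => _) =
    (fun w => a j * X j w) \+ (fun w => \sum_(j <- r) a j * X j w)).
  by apply: Lfun2D => //; exact: Lfun2Z.
by apply/funext => w; rewrite big_cons.
Qed.

Lemma cvg_l2_sum {I J : Type} {F : set_system I} {FF : Filter F} (r : seq J)
    (a : J -> R) (X_ : J -> I -> Om -> R) (X : J -> Om -> R) :
  (forall j i, X_ j i \in Lfun P 2%:E) -> (forall j, X j \in Lfun P 2%:E) ->
  (forall j, l2 P (X_ j i \- X j) @[i --> F] --> (0 : R)) ->
  l2 P ((fun w => \sum_(j <- r) a j * X_ j i w) \-
        (fun w => \sum_(j <- r) a j * X j w)) @[i --> F] --> (0 : R).
Proof.
move=> X_2 X2 X_X.
have X_X2 j i : X_ j i \- X j \in Lfun P 2%:E by exact: Lfun2B.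
suff : l2 P (fun w => \sum_(j <- r) a j * (X_ j i \- X j) w)
    @[i --> F] --> (0 : R).
  rewrite (_ : (fun i => _) = (fun i => l2 P
    ((fun w => \sum_(j <- r) a j * X_ j i w) \-
     (fun w => \sum_(j <- r) a j * X j w))))//.
  apply/funext => i; congr (l2 P _); apply/funext => w /=.
  by rewrite -sumrB; apply: eq_bigr => j _; rewrite mulrBr.
elim: r => [|j r IH].
  rewrite (_ : (fun i => _) = cst 0); first exact: cvg_cst.
  apply/funext => i; rewrite /l2 (_ : (fun w => _) = cst 0).
    by rewrite expectation_cst sqrtr0.
  by apply/funext => w; rewrite big_nil expr0n.
have b0 : 2 * (`|a j| * l2 P (X_ j i \- X j) +
    l2 P (fun w => \sum_(j <- r) a j * (X_ j i \- X j) w))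
    @[i --> F] --> (0 : R).
  rewrite -[X in _ --> X](mulr0 2); apply: cvgM; first exact: cvg_cst.
  rewrite -[X in _ --> X]addr0; apply: cvgD => //.
  rewrite -[X in _ --> X](mulr0 `|a j|); apply: cvgM => //; exact: cvg_cst.
apply: dist_le_cvg b0 => i; rewrite subr0 ger0_norm ?l2_ge0//.
rewrite (_ : (fun w => _) = (fun w => a j * (X_ j i \- X j) w) \+
    (fun w => \sum_(j <- r) a j * (X_ j i \- X j) w)).
  rewrite -l2Z//; apply: ler_l2D; first exact: Lfun2Z.
  exact: (@Lfun2_sum _ r a (fun j => X_ j i \- X j)).
by apply/funext => w; rewrite big_cons.
Qed.

(** The covariance of [Z x] with itself is finite, so the centered variable is in L^2; adding the
    constant back stays there. *)
Lemma gaussian_process_Lfun2 {T : Type} (Z : T -> {RV P >-> R}) mu K :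
  gaussian_process Z mu K -> forall x, (Z x : Om -> R) \in Lfun P 2%:E.
Proof.
case=> _ _ ZK x; set c := fine 'E_P[Z x].
have Zc2 : (Z x : Om -> R) \- cst c \in Lfun P 2%:E.
  apply: sqr_expectation_Lfun2; first exact: measurable_funB.
  by have := ZK x x; rewrite unlock -/c => ->; rewrite ltry.
rewrite (_ : (Z x : Om -> R) = ((Z x : Om -> R) \- cst c) \+ cst c).
  by apply: Lfun2D => //; exact: Lfun2_cst.
by apply/funext => w /=; rewrite subrK.
Qed.

Context {n : nat} {M : smooth_manifold R n}.
Variables (e : M -> 'rV[R]_n -> M) (V : M -> 'rV[R]_n).
Variables (Z DZ : M -> {RV P >-> R}) (mu : M -> R) (K : M -> M -> R).
Hypothesis gaussZ : gaussian_process Z mu K.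
Hypothesis DZ_def : derivative_process e V Z DZ.

Let quot (x : M) (t : R) (w : Om) : R := (Z (e x (t *: V x)) w - Z x w) / t.

Let quotE x t : quot x t =
  (fun w => t^-1 * ((Z (e x (t *: V x)) : Om -> R) \- Z x) w).
Proof. by apply/funext => w; rewrite mulrC. Qed.

Let Z2 x : (Z x : Om -> R) \in Lfun P 2%:E.
Proof. exact: gaussian_process_Lfun2 gaussZ x. Qed.

Let quot2 x t : quot x t \in Lfun P 2%:E.
Proof. by rewrite quotE; apply: Lfun2Z; exact: Lfun2B. Qed.

Let DZ2 x : (DZ x : Om -> R) \in Lfun P 2%:E.
Proof. exact: (ms_limit_Lfun2 (quot2 x) _ (@DZ_def x)). Qed.

Let quot_cvg x : l2 P (quot x t \- DZ x) @[t --> (0 : R)^'] --> (0 : R).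
Proof. exact: cvg_l2 (@DZ_def x). Qed.

Lemma derivative_process_mean (x : M) :
  (mu (e x (t *: V x)) - mu x) / t @[t --> (0 : R)^'] --> mean P (DZ x).
Proof.
have [_ Zmu _] := gaussZ.
rewrite (_ : (fun t => _) = (fun t => mean P (quot x t))).
  by apply: cvg_mean => //.
apply/funext => t; rewrite quotE meanZ ?Lfun2B// meanB// mulrC.
by rewrite /mean !Zmu.
Qed.

(** By bilinearity, the mixed quotient of [K] is the covariance of the difference quotients of [Z]
    at [x] and [x']. *)
Lemma derivative_process_cov (x x' : M) :
  mixed_quotient e V K x x' @ mixed_filter --> cov_fun DZ x x'.
Proof.
have [_ _ ZK] := gaussZ.
have KE y y' : K y y' = cov P (Z y) (Z y') by rewrite /cov ZK.
rewrite (_ : mixed_quotient e V K x x' =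
    (fun ts => cov P (quot x ts.1) (quot x' ts.2))).
  exact: (cvg_cov (quot2 x) (DZ2 x) (quot2 x') (DZ2 x')).
apply/funext => -[t s]; rewrite /mixed_quotient/= !KE invfM.
rewrite [in RHS]quotE covZl ?Lfun2B// [in RHS]covC.
rewrite [in RHS]quotE covZl ?Lfun2B//.
rewrite covBl ?Lfun2B// !covBr//.
by rewrite ![cov _ (Z (e x' _)) _]covC ![cov _ (Z x') _]covC; ring.
Qed.

(** Mean and covariance are those of [DZ] itself, so that the conclusion can serve as hypothesis for
    a further derivative. *)
Lemma derivative_process_gaussian :
  gaussian_process DZ (fun x => mean P (DZ x)) (cov_fun DZ).
Proof.
split => [k x a|x|x x']; last 2 first.
- exact: meanE.
- exact: covE.
have [Zn _ _] := gaussZ.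
pose S t w := \sum_(j < k) a j * quot (x j) t w.
apply: (@normal_variable_ms_limit _ _ _ P R (0 : R)^' _ S).
- by move=> t; exact: Lfun2_sum.
- by apply: (@Lfun2_sum _ _ a (fun i => DZ (x i) : Om -> R)).
- move=> t.
  (* A combination of [k] difference quotients is a combination of [2k] values of [Z]: the moved
     points with weights [a i / t], the base points with the opposite weights. *)
  pose y (j : 'I_(k + k)) := match fintype.split j with
    | inl i => e (x i) (t *: V (x i)) | inr i => x i end.
  pose b (j : 'I_(k + k)) := match fintype.split j with
    | inl i => a i / t | inr i => - (a i / t) end.
  have := Zn _ y b; rewrite (_ : (fun w => _) = S t)//.
  apply/funext => w; rewrite big_split_ord/= /S -big_split/=.
  apply: eq_bigr => j _; rewrite /y /b.
  by rewrite (unsplitK (inl j)) (unsplitK (inr j)) /quot; ring.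
- exact: (@cvg_l2_sum _ _ _ _ _ a (fun j => quot (x j))
    (fun j => DZ (x j) : Om -> R)).
Qed.

End DerivativeProcess.

(** * The curvature process *)

Theorem lemma3p12 (R : realType) (n : nat) (M : smooth_manifold R n)
    (g : riemannian_metric M) (compactM : compact [set: M])
    (e : M -> 'rV[R]_n -> M) (exp_e : exponential_map g e)
    (d : measure_display) (Om : measurableType d) (P : probability Om R)
    (Z : M -> {RV P >-> R}) (mu : M -> R) (K : M -> M -> R)
    (mu2 : twice_differentiable mu) (gaussZ : gaussian_process Z mu K)
    (U V : M -> 'rV[R]_n)
    (smoothU : smooth_vector_field U) (smoothV : smooth_vector_field V)
    (msd2Z : MSD2 g e Z)
    (DVZ : M -> {RV P >-> R}) (DVZ_def : derivative_process e V Z DVZ)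
    (D2UVZ : M -> {RV P >-> R})
    (D2UVZ_def : derivative_process e U DVZ D2UVZ) :
  let KV := cov_fun DVZ in
  let KUV := mixed_derivative e U KV in
  [/\ gaussian_process D2UVZ (hessian g e mu V U) KUV,
      forall x, derivable (hessian_curve g e mu V U x) 0 1,
      forall x x', mixed_derivable e U KV x x' &
      forall x x',
        [/\ mixed_derivable e V K x x',
            mixed_derivable e U (mixed_derivative e V K) x x' &
            KUV x x' = mixed_derivative e U (mixed_derivative e V K) x x']].
Proof.
move=> KV KUV.
have gaussDV := derivative_process_gaussian gaussZ DVZ_def.
have gaussD2 := derivative_process_gaussian gaussDV D2UVZ_def.
(* The same quotients of [mu] converge to both sides; limits are unique. *)
have mDV x : mean P (DVZ x) = grad_along g mu V x.
  have cvg_mean := derivative_process_mean gaussZ DVZ_def (x := x).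
  rewrite -(cvg_lim (@norm_hausdorff _ R^o) cvg_mean).
  by apply: cvg_lim => //; exact: cvg_grad_along.
have e0 x : e x 0 = x.
  have [gamma [_ g0 _ eg]] := exponential_map_geodesic x 0 exp_e.
  by rewrite -(scale0r 0) eg.
(* By [mDV], the quotients of the mean of [DVZ] along [U] are those of [hessian_curve]; derivability
   at 0 thus comes from mean-square convergence, and [e0] identifies the value at 0. *)
have hessian_cvg x : (fun h => h^-1 *:
    ((hessian_curve g e mu V U x \o shift 0) (h *: 1) -
     hessian_curve g e mu V U x 0)) @ (0 : R)^' --> mean P (D2UVZ x).
  have := derivative_process_mean gaussDV D2UVZ_def (x := x); apply: cvg_trans.
  apply: near_eq_cvg; apply: nearW => t; rewrite !mDV /= /hessian_curve.
  by rewrite scale0r e0 addr0 mulrC -[(t *: 1)%R]/(t * 1) mulr1.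
have hessianE : hessian g e mu V U = (fun x => mean P (D2UVZ x)).
  by apply/funext => x; rewrite /hessian derive1E; apply: cvg_lim.
have KVE : mixed_derivative e V K = KV.
  apply/funext => x; apply/funext => x'.
  by apply: cvg_lim => //; exact: (derivative_process_cov gaussZ DVZ_def).
have KUV_cvg x x' :=
  derivative_process_cov gaussDV D2UVZ_def (x := x) (x' := x').
have KUVE : KUV = cov_fun D2UVZ.
  apply/funext => x; apply/funext => x'.
  by apply: cvg_lim => //; exact: KUV_cvg.
split.
- by rewrite hessianE KUVE.
- by move=> x; apply: cvgP (hessian_cvg x).
- by move=> x x'; apply: cvgP (KUV_cvg x x').
- move=> x x'; rewrite KVE; split => //.
  + exact: cvgP (derivative_process_cov gaussZ DVZ_def (x := x) (x' := x')).
  + exact: cvgP (KUV_cvg x x').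
Qed.
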